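(* Let $G$ be a nontrivial finite $2$-generated nilpotent group. Then (i) $\Delta(G)$ is Eulerian if and only if $G$ is not a cyclic group of even order; (ii) $\Delta(G)$ is Hamiltonian if and only if $G$ is not the cyclic group of order two.
   Context: A group is $2$-generated if it can be generated by two elements (cyclic groups are included). The generating graph $\Gamma(G)$ of a finite group $G$ is the simple graph whose vertices are the elements of $G$ and where distinct $g,h \in G$ are adjacent if $G = \langle g,h\rangle$ (no loops, even when $G$ is cyclic). $\Delta(G)$ is the graph obtained from $\Gamma(G)$ by removing its isolated vertices. A graph is Hamiltonian if it contains a cycle (of length at least $3$) containing every vertex exactly once, and Eulerian if it has a closed walk (possibly repeating vertices) that traverses every edge exactly once. *)

(* Defs.v *)
From mathcomp Require Import all_boot all_fingroup all_solvable.

Set Implicit Arguments.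
Unset Strict Implicit.
Unset Printing Implicit Defensive.

(* The vertices form a subset of T, so that removing vertices does not change
   the ambient type. *)
Record sgraph (T : finType) := SGraph {
  vertices : {set T};
  adj : rel T;
  adj_sym : symmetric adj;
  adj_irr : irreflexive adj;
  adj_vertices : forall x y, adj x y -> (x \in vertices) && (y \in vertices)
}.

Section Graphs.
Variable T : finType.
Implicit Type D : sgraph T.

Definition isolated D (x : T) : bool :=
  (x \in vertices D) && [forall y, ~~ adj D x y].

Section Induced.
Variables (D : sgraph T) (A : {set T}).

Definition induced_adj : rel T :=
  [rel x y | [&& x \in A, y \in A & adj D x y]].

Lemma induced_adj_sym : symmetric induced_adj.
Proof. by move=> x y; rewrite /induced_adj /= adj_sym andbCA. Qed.

Lemma induced_adj_irr : irreflexive induced_adj.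
Proof. by move=> x; rewrite /induced_adj /= adj_irr !andbF. Qed.

Lemma induced_adj_vertices x y :
  induced_adj x y -> (x \in vertices D :&: A) && (y \in vertices D :&: A).
Proof.
by case/and3P=> xA yA /adj_vertices/andP[xD yD]; rewrite !inE xA yA xD yD.
Qed.

Definition induced : sgraph T :=
  SGraph induced_adj_sym induced_adj_irr induced_adj_vertices.

End Induced.

Definition remove_isolated D : sgraph T :=
  induced D [set x in vertices D | ~~ isolated D x].

Definition hamiltonian D : Prop :=
  exists c : seq T,
    [/\ 2 < size c, path.cycle (adj D) c, uniq c & c =i vertices D].

(* zip truncates to the shorter list, so this is (x, p_0), (p_0, p_1), ..., up
   to the last two vertices of the walk x :: p. *)
Definition walk_steps (x : T) (p : seq T) : seq (T * T) := zip (x :: p) p.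

(* An edge {u, v} is unordered: a step along it in either direction counts as
   a traversal. *)
Definition traversals (x : T) (p : seq T) (u v : T) : nat :=
  count [pred s | [set s.1; s.2] == [set u; v]] (walk_steps x p).

Definition eulerian D : Prop :=
  exists x : T, exists p : seq T,
    [/\ x \in vertices D, path (adj D) x p, last x p = x
      & forall u v, adj D u v -> traversals x p u v = 1].

End Graphs.

Section GeneratingGraph.
Variables (gT : finGroupType) (G : {group gT}).

Definition two_generated : Prop :=
  exists x y : gT, <<[set x; y]>>%g = G.

Definition gen_adj : rel gT :=
  [rel x y | [&& x \in G, y \in G, x != y & <<[set x; y]>>%g == G]].

Lemma gen_adj_sym : symmetric gen_adj.
Proof. by move=> x y; rewrite /gen_adj /= andbCA eq_sym setUC. Qed.

Lemma gen_adj_irr : irreflexive gen_adj.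
Proof. by move=> x; rewrite /gen_adj /= eqxx !andbF. Qed.

Lemma gen_adj_vertices x y : gen_adj x y -> (x \in (G : {set gT})) && (y \in (G : {set gT})).
Proof. by case/and4P=> -> ->. Qed.

Definition generating_graph : sgraph gT :=
  SGraph gen_adj_sym gen_adj_irr gen_adj_vertices.

Definition Delta_graph : sgraph gT := remove_isolated generating_graph.

End GeneratingGraph.

(* Main.v *)
Require Import Defs.
From mathcomp Require Import all_boot all_fingroup all_solvable.
From mathcomp Require Import zify.

Set Implicit Arguments.
Unset Strict Implicit.
Unset Printing Implicit Defensive.

(** Why the theorem holds.

    Hamiltonicity.  Write V(G) for the set of elements of G that belong to a
    generating pair; for G <> 1 these are the vertices of Delta(G).  It suffices
    to list V(G) cyclically so that any two successive entries generate G
    ([nilpotent_gen_cycle]).  If G = <g>, the list 1, g, g^2, ... works, because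
    g = g^-i g^(i+1).  Otherwise some Sylow subgroup P of G is not cyclic, and
    G = H x P with |H| and |P| coprime.  A pair generates G if and only if its
    components generate H and P ([generates_dprod]), so V(G) = V(H) x V(P), and
    V(H) is listed by induction on |G|.

    In the 2-generated noncyclic p-group P, any two maximal subgroups meet in
    the Frattini subgroup Phi(P) ([maximal_capE]), and V(P) = P - Phi(P).
    Hence the sets M - Phi(P), for M maximal, split V(P) into at least three
    blocks of the same size, and two elements of different blocks always
    generate P.  Taking elements from the blocks in rotation gives a cyclic list
    of V(P) where entries at distance one or two generate P
    ([pgroup_gen_cycle]).  The freedom to advance by one or two is what allows
    the lists of V(H) and V(P) to be merged into one of V(H) x V(P), even when
    their lengths have a common factor ([cyclic_enum_setX]).

    Eulerian circuits.  A graph with a vertex has a closed walk through every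
    edge exactly once if it is connected and all its degrees are even; the even
    degrees are also necessary.  Connectedness of Delta(G) comes from a
    Hamiltonian cycle.  For the degree of x: if x generates G it is |G| - 1.  If
    not, the neighbours of x are permuted without fixed points by an
    involution: y |-> y t with t of order 2 in <x> when x has even order, and
    y |-> y^-1 when x has odd order.  In the latter case a fixed y has order at
    most 2, so that x and y have coprime orders, commute in the nilpotent group
    G, and make G cyclic of even order ([even_degree]). *)

(** * Eulerian circuits *)

Section Euler.
Variables (T : finType) (D : sgraph T).
Implicit Types (x y z u v : T) (p q : seq T).

(** A walk is closed and traverses every edge once exactly when this list has
    no repetition and exhausts the edges; this turns the count of traversals
    into statements about lists. *)
Definition walk_edges x p : seq {set T} :=
  [seq [set s.1; s.2] | s <- walk_steps x p].

Definition neighbours x : {set T} := [set y | adj D x y].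

Lemma walk_edges_cons x y p :
  walk_edges x (y :: p) = [set x; y] :: walk_edges y p.
Proof. by []. Qed.

Lemma walk_edges_cat x p q :
  walk_edges x (p ++ q) = walk_edges x p ++ walk_edges (last x p) q.
Proof. by elim: p x => //= y p IHp x; rewrite !walk_edges_cons IHp. Qed.

Lemma size_walk_edges x p : size (walk_edges x p) = size p.
Proof. by elim: p x => //= y p IHp x; rewrite /= IHp. Qed.

Lemma traversals_count x p u v :
  traversals x p u v = count_mem [set u; v] (walk_edges x p).
Proof. by rewrite count_map. Qed.

Lemma set2_inj v : injective (fun y : T => [set v; y]).
Proof.
move=> y z /setP eq_vyz; have := eq_vyz y; have := eq_vyz z.
rewrite !inE !eqxx !orbT; have [-> | _] := eqVneq z v; last by move/eqP.
by rewrite orbb => _ /esym/eqP.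
Qed.

Lemma walk_edgesP x p e :
  path (adj D) x p -> e \in walk_edges x p ->
  exists u v, adj D u v /\ e = [set u; v].
Proof.
elim: p x => //= y p IHp x /andP[adj_xy /IHp{}IHp].
by rewrite inE => /predU1P[-> | /IHp //]; exists x, y.
Qed.

Lemma walk_edges_sub x p e z : e \in walk_edges x p -> z \in e -> z \in x :: p.
Proof.
elim: p x => //= y p IHp x; rewrite walk_edges_cons inE.
case/predU1P=> [-> | /IHp{}IHp /IHp z_p].
  by rewrite !inE => /orP[]->; rewrite ?orbT.
by rewrite inE z_p orbT.
Qed.

(** Every passage of the walk through v uses two edges at v, so only the two
    ends of the walk contribute to the parity. *)
Lemma odd_incident x p v :
  path (adj D) x p ->
  odd (count (fun e : {set T} => v \in e) (walk_edges x p))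
    = (v == x) (+) (v == last x p).
Proof.
elim: p x => [|y p IHp] x; first by rewrite addbb.
rewrite walk_edges_cons /= => /andP[adj_xy /IHp{}IHp].
rewrite oddD IHp oddb !inE addbA; congr (_ (+) _).
have [-> /= | _] := eqVneq v x; last by rewrite orFb addbb.
by have [eq_xy | _ //] := eqVneq x y; rewrite eq_xy adj_irr in adj_xy.
Qed.

Lemma trail_incident x p v :
    path (adj D) x p -> uniq (walk_edges x p) ->
  count (fun e : {set T} => v \in e) (walk_edges x p)
    = #|[set y in neighbours v | [set v; y] \in walk_edges x p]|.
Proof.
move=> walk_p trail_p; rewrite -size_filter cardE -(size_map (fun y => [set v; y])).
apply/perm_size/uniq_perm.
- exact: filter_uniq.
- by rewrite (map_inj_uniq (@set2_inj v)) enum_uniq.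
move=> e; rewrite mem_filter; apply/andP/mapP=> [[ve e_p] | [y]]; last first.
  by rewrite mem_enum inE => /andP[_ e_p] ->; rewrite !inE eqxx.
have [u [w [adj_uw def_e]]] := walk_edgesP walk_p e_p.
move: ve e_p; rewrite def_e !inE => /pred2P[]-> e_p; [exists w | exists u].
- by rewrite mem_enum !inE adj_uw.
- by [].
- by rewrite mem_enum !inE adj_sym adj_uw setUC.
- by rewrite setUC.
Qed.

Lemma eulerian_even_degree v : eulerian D -> ~~ odd #|neighbours v|.
Proof.
case=> x [p [_ walk_p closed_p once_p]].
have in_p u w : adj D u w -> [set u; w] \in walk_edges x p.
  by move/once_p; rewrite traversals_count -has_pred1 has_count => ->.
have trail_p : uniq (walk_edges x p).
  apply: count_mem_uniq => e; have [e_p | /count_memPn-> //] := boolP (e \in _).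
  have [u [w [adj_uw def_e]]] := walk_edgesP walk_p e_p.
  by rewrite def_e -traversals_count once_p.
have <- : [set y in neighbours v | [set v; y] \in walk_edges x p] = neighbours v.
  by apply/setP=> y; rewrite !inE; case: (boolP (adj D v y)) => // /in_p.
by rewrite -trail_incident // odd_incident // closed_p addbb.
Qed.

(** A walk without repeated edges is no longer than the number of unordered
    pairs, so a longest one exists. *)
Lemma max_trail x0 :
    x0 \in vertices D ->
  exists x p, [/\ x \in vertices D, path (adj D) x p, uniq (walk_edges x p)
    & forall y q, y \in vertices D -> path (adj D) y q ->
        uniq (walk_edges y q) -> size q <= size p].
Proof.
move=> Dx0; pose N := #|{set T}|.
pose is_trail k := [exists x in vertices D, exists p : k.-tuple T,
  path (adj D) x p && uniq (walk_edges x p)].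
have ex_trail : exists k, is_trail k.
  by exists 0; apply/existsP; exists x0; rewrite Dx0; apply/existsP; exists [tuple].
have bounded k : is_trail k -> k <= N.
  case/exists_inP=> x _ /existsP[p /andP[_ /card_uniqP]].
  by rewrite size_walk_edges size_tuple => <-; apply: max_card.
case: (ex_maxnP ex_trail bounded) => k /exists_inP[x Dx /existsP[p]].
case/andP=> walk_p trail_p max_k.
exists x, p; split=> // y q Dy walk_q trail_q; rewrite size_tuple; apply: max_k.
by apply/exists_inP; exists y => //; apply/existsP; exists (in_tuple q); rewrite walk_q.
Qed.

(** A trail that cannot be prolonged uses all edges at its last vertex.  As
    their number is even, the parity count forces that vertex to be the first
    one. *)
Lemma max_trail_closed x p :
    (forall v, ~~ odd #|neighbours v|) ->
    path (adj D) x p -> uniq (walk_edges x p) ->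
    (forall y, path (adj D) x (rcons p y) -> ~~ uniq (walk_edges x (rcons p y))) ->
  last x p = x /\ forall y, adj D x y -> [set x; y] \in walk_edges x p.
Proof.
move=> even_deg walk_p trail_p max_p.
have stuck y : adj D (last x p) y -> [set last x p; y] \in walk_edges x p.
  move=> adj_y; have := max_p y; rewrite rcons_path walk_p adj_y => /(_ isT).
  rewrite -cats1 walk_edges_cat cats1 rcons_uniq trail_p andbT.
  by rewrite negbK.
have closed_p : last x p = x.
  apply/eqP; have := odd_incident (last x p) walk_p.
  rewrite trail_incident // eqxx addbT.
  have -> : [set y in neighbours (last x p) | [set last x p; y] \in walk_edges x p]
      = neighbours (last x p).
    by apply/setP=> y; rewrite !inE; case: (boolP (adj _ _ _)) => // /stuck.
  by rewrite (negPf (even_deg _)) => /esym/negbFE.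
by split=> //; rewrite -{1 2}closed_p.
Qed.

(** A longest trail is closed, hence can be rotated to end at any of its
    vertices; being unextendable there, it uses all edges at each of its
    vertices.  Its vertices are thus closed under adjacency, so by
    connectedness they are all the vertices. *)
Lemma even_degree_eulerian x0 :
    x0 \in vertices D ->
    {in vertices D &, forall x y, connect (adj D) x y} ->
    (forall v, ~~ odd #|neighbours v|) ->
  eulerian D.
Proof.
move=> Dx0 connD even_deg.
have [x [p [Dx walk_p trail_p max_p]]] := max_trail Dx0.
have stop y q z : y \in vertices D -> size q = size p ->
    path (adj D) y (rcons q z) -> ~~ uniq (walk_edges y (rcons q z)).
  move=> Dy sz_q walk_qz; apply/negP=> /(max_p _ _ Dy walk_qz).
  by rewrite size_rcons sz_q ltnn.
have stop_p z := @stop x p z Dx erefl.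
have [closed_p _] := max_trail_closed even_deg walk_p trail_p stop_p.
(* Rotate the trail at v: x --p1--> v --p2--> x becomes v --p2--> x --p1--> v. *)
have sat_p v y : v \in x :: p -> adj D v y -> [set v; y] \in walk_edges x p.
  move=> v_p adj_vy; have /andP[Dv _] := adj_vertices adj_vy.
  case/splitPl: v_p walk_p trail_p closed_p stop {max_p} => p1 p2 last_p1.
  rewrite cat_path last_p1 walk_edges_cat last_cat last_p1.
  move=> /andP[walk1 walk2] trail12 closed12 stop.
  have walk21 : path (adj D) v (p2 ++ p1) by rewrite cat_path closed12 walk2.
  have edges21 : perm_eq (walk_edges v (p2 ++ p1)) (walk_edges x p1 ++ walk_edges v p2).
    by rewrite walk_edges_cat closed12 perm_catC.
  have trail21 : uniq (walk_edges v (p2 ++ p1)) by rewrite (perm_uniq edges21).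
  have [| _ sat] := max_trail_closed even_deg walk21 trail21.
    by move=> z; apply: stop; rewrite // !size_cat addnC.
  by rewrite -(perm_mem edges21); apply: sat.
have all_p v : v \in vertices D -> v \in x :: p.
  move=> Dv; have /connectP[q walk_q ->] := connD _ _ Dx Dv.
  have: x \in x :: p by exact: mem_head.
  elim: q {-3 5}x walk_q => //= z q IHq y /andP[adj_yz walk_q] y_p.
  apply: IHq => //; have := sat_p _ _ y_p adj_yz.
  by move/walk_edges_sub; apply; rewrite set22.
exists x, p; split=> // u v adj_uv; rewrite traversals_count count_uniq_mem // sat_p //.
by have /andP[/all_p] := adj_vertices adj_uv.
Qed.

End Euler.

(** * Cyclic enumerations *)

(** The sequence c has period n and runs through A once in each period.  A
    total function on nat, rather than a list of length n, avoids a special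
    case where the list wraps around. *)
Definition cyclic_enum (T : finType) (A : {set T}) (n : nat) (c : nat -> T) : Prop :=
  [/\ 0 < n, forall i j, (c i == c j) = (i == j %[mod n])
    & forall x, x \in A <-> exists i, x = c i].

Lemma eqn_modM i j m n :
  0 < m -> 0 < n ->
  (i == j %[mod m * n]) = (i == j %[mod m]) && (i %/ m == j %/ m %[mod n]).
Proof.
move=> m_gt0 n_gt0.
have modE k : k %% (m * n) = k %/ m %% n * m + k %% m.
  rewrite {1}(divn_eq k m) {1}(divn_eq (k %/ m) n) mulnDl -mulnA -addnA.
  rewrite [n * m]mulnC modnMDl modn_small //.
  have := ltn_pmod (k %/ m) n_gt0; have := ltn_pmod k m_gt0; nia.
rewrite !modE; apply/eqP/andP=> [eq_ij | [/eqP-> /eqP-> //]].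
have eq_m : i %% m = j %% m.
  by have /(congr1 (modn^~ m)) := eq_ij; rewrite !modnMDl !modn_mod.
split; first exact/eqP.
by move/eqP: eq_ij; rewrite eq_m eqn_add2r eqn_pmul2r.
Qed.

Lemma cyclic_enum_hamiltonian (T : finType) (D : sgraph T) n c :
    2 < #|vertices D| -> cyclic_enum (vertices D) n c ->
    (forall i, adj D (c i) (c i.+1)) ->
  hamiltonian D.
Proof.
move=> V_gt2 [n_gt0 cE c_onto] adj_c.
have uniq_c : uniq (mkseq c n).
  apply/mkseq_uniqP=> i j ltin ltjn /eqP.
  by rewrite cE !modn_small // => /eqP.
have mem_c : mkseq c n =i vertices D.
  move=> x; apply/mapP/idP=> [[i _ ->] | /c_onto[i ->]].
    by apply/c_onto; exists i.
  exists (i %% n); first by rewrite mem_iota ltn_pmod.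
  by apply/eqP; rewrite cE modn_mod.
exists (mkseq c n); split=> //; first by rewrite -(card_uniqP uniq_c) (eq_card mem_c).
case: n n_gt0 cE {uniq_c mem_c c_onto} => // n _ cE.
have walk k i : path (adj D) (c i) [seq c j | j <- iota i.+1 k].
  by elim: k i => [|k IHk] i; rewrite /= ?adj_c ?IHk.
have := walk (n + 1) 0; rewrite iotaD map_cat /= cats1.
suff -> : c (1 + n) = c 0 by [].
by apply/eqP; rewrite cE add1n modnn.
Qed.

(** The sequence 0, 1, 0, 1, ... of length m, whose last term is replaced by 2
    when m is even: successive terms differ by 1 or 2, and the last term differs
    from 1 by exactly 1. *)
Definition zigzag (m i : nat) : nat := if odd i && (i == m.-1) then 2 else odd i.

(** The first component runs through A again and again, in n rounds.  Pairing
    its i-th position in round r with d (r + a_i) reaches every element of B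
    once as r varies, whatever the shifts a_i are.  The zigzag shifts make the
    index of d change by 1 or 2, forwards or backwards, both inside a round and
    from a_(m-1) in round r to 1 + a_0 = 1 in round r + 1. *)
Lemma cyclic_enum_setX (T1 T2 : finType) (A : {set T1}) (B : {set T2})
    (e1 : rel T1) (e2 : rel T2) m n (c : nat -> T1) (d : nat -> T2) :
    symmetric e2 -> cyclic_enum A m c -> cyclic_enum B n d ->
    (forall i, e1 (c i) (c i.+1)) ->
    (forall i, e2 (d i) (d i.+1)) -> (forall i, e2 (d i) (d i.+2)) ->
  exists f, cyclic_enum (setX A B) (m * n) f /\
    forall i, e1 (f i).1 (f i.+1).1 && e2 (f i).2 (f i.+1).2.
Proof.
move=> e2sym [m_gt0 cE c_onto] [n_gt0 dE d_onto] step_c step1 step2.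
exists (fun t => (c t, d (t %/ m + zigzag m (t %% m)))); split.
  split=> [||[x u]]; first by rewrite muln_gt0 m_gt0.
    move=> i j; rewrite xpair_eqE cE dE eqn_modM //.
    by apply: andb_id2l => /eqP->; rewrite eqn_modDr.
  rewrite inE /=; split=> [/andP[/c_onto[i ->] /d_onto[j ->]] | [i [-> ->]]].
    (* Round j + a (n - 1) shifted by a is j + a n, that is, j modulo n. *)
    pose a := zigzag m (i %% m); exists ((j + a * n.-1) * m + i %% m).
    congr (_, _); apply/eqP; first by rewrite cE modnMDl modn_mod.
    rewrite divnMDl // divn_small ?ltn_pmod // addn0 modnMDl modn_mod -/a dE.
    by rewrite -addnA -mulnSr prednK // addnC modnMDl.
  by apply/andP; split; [apply/c_onto; exists i | apply/d_onto; eexists].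
move=> t /=; rewrite step_c /= {step_c cE c_onto dE d_onto}.
have lt_im := ltn_pmod t m_gt0; move: (t %% m) (t %/ m) (divn_eq t m) lt_im.
move=> i r -> lt_im; rewrite -addnS divnMDl // modnMDl.
have [lt_Sim | le_mSi] := ltnP i.+1 m.
  rewrite divn_small // addn0 modn_small // /zigzag.
  have -> : (i == m.-1) = false by lia.
  rewrite andbF /=; case: (odd i) => /=; first by rewrite e2sym addn1 addn0.
  by case: ifP => _; rewrite addn0 ?addn2 ?addn1.
have -> : i.+1 = m by lia.
rewrite divnn modnn m_gt0 /zigzag /= addn0.
have -> : i == m.-1 by lia.
by rewrite andbT; case: (odd i); rewrite ?addn2 ?addn1 ?addn0 // e2sym.
Qed.

(** Taking one element from each of the q blocks in rotation: the i-th element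
    is the (i / q)-th one of the block with number i mod q. *)
Lemma cyclic_enum_blocks (T : finType) (B : nat -> {set T}) q k :
    0 < q -> 0 < k -> (forall i, i < q -> #|B i| = k) ->
    (forall i j x, i < q -> j < q -> x \in B i -> x \in B j -> i = j) ->
  exists c, cyclic_enum (\bigcup_(i < q) B i) (q * k) c
    /\ forall i, c i \in B (i %% q).
Proof.
move=> q_gt0 k_gt0 cardB disjB.
have [x0 _] : exists x0, x0 \in B 0 by apply/card_gt0P; rewrite cardB.
pose c i := nth x0 (enum (B (i %% q))) (i %/ q %% k).
have cB i : c i \in B (i %% q).
  by rewrite -mem_enum mem_nth // -cardE cardB ltn_pmod.
exists c; split=> //; split; first by rewrite muln_gt0 q_gt0.
  move=> i j; rewrite eqn_modM //; apply/eqP/andP=> [eq_c | [/eqP eq_q /eqP eq_k]].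
    have eq_q : i %% q = j %% q.
      by apply: (disjB _ _ (c i)); rewrite ?ltn_pmod // eq_c.
    split; first exact/eqP.
    move/eqP: eq_c; rewrite /c eq_q nth_uniq ?enum_uniq //.
    + by rewrite -cardE cardB ltn_pmod.
    + by rewrite -cardE cardB ltn_pmod.
  by rewrite /c eq_q eq_k.
move=> x; split=> [/bigcupP[i _ Bx] | [i ->]]; last first.
  by apply/bigcupP; exists (Ordinal (ltn_pmod i q_gt0)).
have lt_xk : index x (enum (B i)) < k by rewrite -(cardB i) // cardE index_mem mem_enum.
exists (index x (enum (B i)) * q + i).
by rewrite /c modnMDl divnMDl // divn_small // addn0 !modn_small // nth_index ?mem_enum.
Qed.

(** * Generating pairs *)

Local Open Scope group_scope.

Section Generating.
Variable gT : finGroupType.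
Implicit Types (G H P K M : {group gT}) (x y u v : gT).

(** Unlike in the generating graph, x may be paired with itself.  This occurs
    when K is cyclic, possibly trivial, and lets pairs in a coprime direct
    product correspond exactly to pairs in its factors. *)
Definition generates K : rel gT := [rel x y | <<[set x; y]>> == K].

Definition gen_verts K : {set gT} := [set x | [exists y, generates K x y]].

Lemma generates_sym K : symmetric (generates K).
Proof. by move=> x y; rewrite /generates /= setUC. Qed.

Lemma generates_mem K x y : generates K x y -> (x \in K) && (y \in K).
Proof. by move/eqP=> <-; rewrite !mem_gen ?set21 ?set22. Qed.

Lemma generates_sub K x y (A : {set gT}) :
  generates K x y -> x \in <<A>> -> y \in <<A>> -> K \subset <<A>>.
Proof. by move/eqP=> <- Ax Ay; rewrite gen_subG subUset !sub1set Ax. Qed.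

Lemma gen_verts_mem K x y :
  generates K x y -> (x \in gen_verts K) && (y \in gen_verts K).
Proof.
move=> Kxy; rewrite !inE; apply/andP; split; apply/existsP.
  by exists y.
by exists x; rewrite generates_sym.
Qed.

Lemma gen_verts_sub K : gen_verts K \subset K.
Proof. by apply/subsetP=> x; rewrite inE => /existsP[y /generates_mem/andP[]]. Qed.

Lemma generates_replace K x y z :
  generates K x y -> z \in K -> y \in <<[set x; z]>> -> generates K x z.
Proof.
move=> Kxy Kz xz_y; have /andP[Kx _] := generates_mem Kxy.
rewrite /generates /= eqEsubset gen_subG subUset !sub1set Kx Kz.
by apply: (generates_sub Kxy) => //; rewrite mem_gen ?set21.
Qed.

Lemma generates_mulr K x y : generates K x y -> generates K x (x * y).
Proof.
move=> Kxy; have /andP[Kx Ky] := generates_mem Kxy.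
apply: (generates_replace Kxy); first by rewrite groupM.
by rewrite -[X in X \in _](mulKg x) groupM ?groupV ?mem_gen ?set21 ?set22.
Qed.

Lemma generates_mull K x y : generates K x y -> generates K y (x * y).
Proof.
rewrite generates_sym => Kyx; have /andP[Ky Kx] := generates_mem Kyx.
apply: (generates_replace Kyx); first by rewrite groupM.
by rewrite -[X in X \in _](mulgK y) groupM ?groupV ?mem_gen ?set21 ?set22.
Qed.

Lemma cyclic_generates K : cyclic K -> exists x, generates K x x.
Proof.
by case/cyclicP=> x defK; exists x; rewrite /generates /= setUid; apply/eqP.
Qed.

Lemma generates_cyclic K x : generates K x x -> cyclic K.
Proof. by rewrite /generates /= setUid => /eqP defK; apply/cyclicP; exists x. Qed.

Definition gen_cycle K n (c : nat -> gT) :=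
  cyclic_enum (gen_verts K) n c /\ forall i, generates K (c i) (c i.+1).

(** The consecutive powers x^i and x^(i+1) generate x. *)
Lemma cyclic_gen_cycle K : cyclic K -> exists n c, gen_cycle K n c.
Proof.
case/cyclicP=> x defK; exists #[x], (fun i => x ^+ i).
have gen_step i : generates K (x ^+ i) (x ^+ i.+1).
  rewrite /generates /= eqEsubset defK gen_subG subUset !sub1set !mem_cycle /= cycle_subG.
  rewrite -[X in X \in _](mulKg (x ^+ i)) -expgSr.
  by rewrite groupM ?groupV ?mem_gen ?set21 ?set22.
split=> //; split=> [|i j|y]; first exact: order_gt0.
  exact: eq_expg_mod_order.
split=> [/(subsetP (gen_verts_sub _)) | [i ->]].
  by rewrite defK => /cycleP[i ->]; exists i.
by have /andP[] := gen_verts_mem (gen_step i).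
Qed.

Section Product.
Variables G H P : {group gT}.
Hypotheses (defG : H \x P = G) (co_HP : coprime #|H| #|P|).

(** As x and u commute and have coprime orders, both are powers of x u, so the
    subgroup generated by x u and y v is the product of those generated by x, y
    in H and by u, v in P. *)
Lemma generates_dprod x y u v : x \in H -> y \in H -> u \in P -> v \in P ->
  generates G (x * u) (y * v) = generates H x y && generates P u v.
Proof.
move=> Hx Hy Pu Pv; have [_ /= mulHP cHP tiHP] := dprodP defG.
have cHPe a b : a \in H -> b \in P -> commute a b.
  by move=> Ha Pb; apply/esym/(centsP cHP).
set A := <<[set x; y]>>%G; set B := <<[set u; v]>>%G.
have sAH : A \subset H by rewrite gen_subG subUset !sub1set Hx.
have sBP : B \subset P by rewrite gen_subG subUset !sub1set Pu.
have parts a b : a \in H -> b \in P -> (a \in <[a * b]>) && (b \in <[a * b]>).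
  move=> Ha Pb; rewrite -!cycle_subG; have cab := cHPe _ _ Ha Pb.
  have co_ab : coprime #[a] #[b].
    by rewrite (coprimeSg _ (coprimegS _ co_HP)) // cycle_subG.
  by rewrite cycleMsub // cab cycleMsub // coprime_sym.
have defAB : <<[set x * u; y * v]>> = A * B.
  rewrite -(cent_joinEr (subset_trans sBP (subset_trans cHP (centS sAH)))).
  have [/andP[x_xu u_xu] /andP[y_yv v_yv]] := (parts _ _ Hx Pu, parts _ _ Hy Pv).
  have s1 : <[x * u]> \subset <<[set x * u; y * v]>> by rewrite genS // sub1set set21.
  have s2 : <[y * v]> \subset <<[set x * u; y * v]>> by rewrite genS // sub1set set22.
  have sAX : A \subset <<[set x * u; y * v]>>.
    by rewrite gen_subG subUset !sub1set (subsetP s1) ?(subsetP s2).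
  have sBX : B \subset <<[set x * u; y * v]>>.
    by rewrite gen_subG subUset !sub1set (subsetP s1) ?(subsetP s2).
  apply/eqP; rewrite eqEsubset [A <*> B \subset _]join_subG sAX sBX andbT.
  rewrite gen_subG subUset !sub1set.
  have [sA sB] := (joing_subl A B, joing_subr A B).
  rewrite andbT; apply/andP; split; apply: groupM;
    by [apply: (subsetP sA); rewrite mem_gen ?set21 ?set22
      | apply: (subsetP sB); rewrite mem_gen ?set21 ?set22].
rewrite /generates /= defAB; apply/eqP/andP=> [defAB_G | [/eqP defA /eqP defB]]; last first.
  by rewrite -mulHP -[X in _ = X * _]defA -[X in _ = _ * X]defB.
have tiAB : A :&: B = 1 by apply/trivgP; rewrite -tiHP setISS.
have leA := subset_leq_card sAH; have leB := subset_leq_card sBP.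
have := TI_cardMg tiAB; rewrite defAB_G -mulHP TI_cardMg // => cards.
have [posA posB] := (cardG_gt0 A, cardG_gt0 B).
have full a b h q : (a * b = h * q)%N -> a <= h -> b <= q -> 0 < a -> 0 < b ->
  h <= a /\ q <= b.
  move=> eqM lea leb a0 b0; split; rewrite leqNgt; apply/negP=> lt; nia.
have [leHA lePB] := full _ _ _ _ (esym cards) leA leB posA posB.
split; [rewrite -[_ == _]/(A == H :> {set gT}) | rewrite -[_ == _]/(B == P :> {set gT})].
  by rewrite eqEcard sAH.
by rewrite eqEcard sBP.
Qed.

Lemma mem_gen_verts_dprod x u : x \in H -> u \in P ->
  (x * u \in gen_verts G) = (x \in gen_verts H) && (u \in gen_verts P).
Proof.
move=> Hx Pu; rewrite !inE; apply/existsP/andP=> [[w Gxuw] | ]; last first.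
  case=> /existsP[y Hxy] /existsP[v Puv]; exists (y * v).
  have [/andP[_ Hy] /andP[_ Pv]] := (generates_mem Hxy, generates_mem Puv).
  by rewrite generates_dprod ?Hxy.
have /andP[_ Gw] := generates_mem Gxuw.
have [y [v [Hy Pv def_w _]]] := mem_dprod defG Gw.
move: Gxuw; rewrite def_w generates_dprod // => /andP[Hxy Puv].
by split; apply/existsP; [exists y | exists v].
Qed.

Lemma dprod_gen_cycle m n c d :
    gen_cycle H m c -> gen_cycle P n d ->
    (forall i, generates P (d i) (d i.+2)) ->
  exists k f, gen_cycle G k f.
Proof.
move=> [enum_c step_c] [enum_d step_d] step2_d.
have [f [[k_gt0 fE f_onto] step_f]] :=
  cyclic_enum_setX (@generates_sym P) enum_c enum_d step_c step_d step2_d.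
have [_ mulHP cHP tiHP] := dprodP defG.
have f_mem i : ((f i).1 \in H) && ((f i).2 \in P).
  have /andP[/generates_mem/andP[-> _] /generates_mem/andP[-> _]] := step_f i.
  by [].
have gen_f i : generates G ((f i).1 * (f i).2) ((f i.+1).1 * (f i.+1).2).
  have [/andP[f1 f2] /andP[f3 f4]] := (f_mem i, f_mem i.+1).
  by rewrite generates_dprod.
exists (m * n)%N, (fun i => (f i).1 * (f i).2); split=> //; split=> // [i j | g].
  rewrite -fE; apply/eqP/eqP=> [eq_ij | -> //].
  have [/andP[f1 f2] /andP[f3 f4]] := (f_mem i, f_mem j).
  have Gi : (f i).1 * (f i).2 \in G by have /generates_mem/andP[] := gen_f i.
  have [x [u [_ _ _ uniq_xu]]] := mem_dprod defG Gi.
  have [eq1 eq2] := uniq_xu _ _ f1 f2 erefl.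
  have [eq3 eq4] := uniq_xu _ _ f3 f4 eq_ij.
  by rewrite [f i]surjective_pairing [f j]surjective_pairing eq1 eq2 eq3 eq4.
split=> [Vg | [i ->]]; last by have /andP[] := gen_verts_mem (gen_f i).
have [x [u [Hx Pu def_g _]]] := mem_dprod defG (subsetP (gen_verts_sub G) _ Vg).
move: Vg; rewrite def_g mem_gen_verts_dprod // => /andP[Vx Vu].
have /f_onto[i def_f] : (x, u) \in setX (gen_verts H) (gen_verts P).
  by rewrite inE /= Vx.
by exists i; rewrite -def_f.
Qed.

End Product.

End Generating.

(** * Noncyclic 2-generated p-groups *)

Section PGroup.
Variables (gT : finGroupType) (p : nat) (P : {group gT}) (x y : gT).
Implicit Types (M : {group gT}) (u v : gT).
Hypotheses (pP : p.-group P) (ncP : ~~ cyclic P) (genP : generates P x y).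

(** P / Phi(P) is elementary abelian, and its rank is its minimal number of
    generators. *)
Lemma Phi_index_le : #|P| <= p ^ 2 * #|'Phi(P)|.
Proof.
have nPhi := normal_norm (Phi_normal P).
rewrite -(Lagrange (Phi_sub P)) -card_quotient // mulnC leq_mul2r.
have pQ := quotient_pgroup 'Phi(P) pP; apply/orP; right.
have abQ := Phi_quotient_abelem pP.
have ntP : P :!=: 1 by apply: contraNneq ncP => ->; apply: cyclic1.
have [p_pr _ _] := pgroup_pdiv pP ntP.
rewrite (card_pgroup pQ) leq_pexp2l ?prime_gt0 //.
rewrite -rank_abelem // -grank_abelian ?(abelem_abelian abQ) //.
apply: leq_trans (quotient_grank nPhi) _.
by rewrite -(eqP genP); apply: leq_trans (grank_min _) _; rewrite cards2; case: eqP.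
Qed.

(** Phi(P) lies in the intersection and has index at most p^2 in P, while the
    intersection has index at least p^2, being properly contained in a subgroup
    of index p. *)
Lemma maximal_capE M1 M2 :
  maximal M1 P -> maximal M2 P -> M1 :!=: M2 -> M1 :&: M2 = 'Phi(P).
Proof.
move=> max1 max2 neq12.
have ntP : P :!=: 1 by apply: contraNneq ncP => ->; apply: cyclic1.
have [p_pr _ _] := pgroup_pdiv pP ntP.
apply/esym/eqP; rewrite eqEcard subsetI !Phi_sub_max //=.
have := Phi_index_le.
have sM1P := maxgroupp max1; have sM2P := maxgroupp max2.
have M1P := proper_sub sM1P; have M2P := proper_sub sM2P.
rewrite -(Lagrange M2P) (p_maximal_index pP max2).
rewrite -(Lagrange (subsetIr M1 M2)).
have ge_p : p <= #|M2 : M1 :&: M2|.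
  have pI : p.-nat #|M2 : M1 :&: M2| :=
    pnat_dvd (dvdn_indexg M2 (M1 :&: M2)) (pgroupS M2P pP).
  have I_gt1 : 1 < #|M2 : M1 :&: M2|.
    rewrite ltn_neqAle indexg_gt0 eq_sym indexg_eq1 subsetI subxx andbT andbT.
    apply: contra neq12 => sM21; rewrite eq_sym eqEcard sM21.
    have := Lagrange M2P; rewrite -(Lagrange M1P) !(p_maximal_index pP) //= => /eqP.
    by rewrite eqn_pmul2r ?prime_gt0 // => /eqP->.
  have := pnatPpi pI; rewrite -pi_pdiv in I_gt1 => /(_ _ I_gt1)/eqnP => <-.
  by rewrite pdiv_leq.
rewrite -mulnA (mulnC #|_ : _|) => le_card.
rewrite -(@leq_pmul2l (p ^ 2)) ?expn_gt0 ?prime_gt0 //; apply: leq_trans le_card.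
by rewrite mulnC leq_pmul2l ?cardG_gt0 // leq_pmul2l ?prime_gt0.
Qed.

Lemma not_generates_max M u v : maximal M P -> u \in M -> v \in M -> ~~ generates P u v.
Proof.
move=> maxM Mu Mv; apply: contraL (maxgroupp maxM) => /eqP <-.
by apply/negP=> /proper_subn; rewrite gen_subG subUset !sub1set Mu Mv.
Qed.

Lemma mem_maximal u : u \in P -> exists2 M : {group gT}, maximal M P & u \in M.
Proof.
rewrite -cycle_subG => /maximal_exists[defP | [M maxM]].
  by case/negP: ncP; rewrite -defP cycle_cyclic.
by rewrite cycle_subG; exists M.
Qed.

(** By [maximal_capE], an element outside Phi(P) lies in only one maximal
    subgroup, so no maximal subgroup contains both u and v. *)
Lemma generates_maximal M1 M2 u v :
    maximal M1 P -> maximal M2 P -> M1 != M2 ->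
    u \in M1 :\: 'Phi(P) -> v \in M2 :\: 'Phi(P) ->
  generates P u v.
Proof.
move=> max1 max2 neq12 /setDP[M1u Phi'u] /setDP[M2v Phi'v].
have only M M' w : maximal M P -> maximal M' P -> w \in M -> w \in M' ->
    w \notin 'Phi(P) -> M = M'.
  move=> maxM maxM' Mw M'w; apply: contraNeq => neqMM'.
  by rewrite -(maximal_capE maxM maxM') // inE Mw.
have P_u : u \in P by apply: subsetP M1u; apply/proper_sub/(maxgroupp max1).
have P_v : v \in P by apply: subsetP M2v; apply/proper_sub/(maxgroupp max2).
have sP : <<[set u; v]>>%G \subset P by rewrite gen_subG subUset !sub1set P_u.
have [defP | [M maxM]] := maximal_exists sP; first exact/eqP.
rewrite gen_subG subUset !sub1set => /andP[Mu Mv].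
case/eqP: neq12; rewrite (only _ _ _ max1 maxM M1u Mu Phi'u).
exact: only maxM max2 Mv M2v Phi'v.
Qed.

Definition maximals := enum [set M : {group gT} | maximal M P].

Lemma mem_maximals M : (M \in maximals) = maximal M P.
Proof. by rewrite mem_enum inE. Qed.

(** Any two of x, y and x y generate P, so they lie in three different maximal
    subgroups. *)
Lemma maximals_gt2 : 2 < size maximals.
Proof.
have genx := generates_mulr genP; have genxy := genP.
have geny := generates_mull genP.
have /andP[Px Py] := generates_mem genP.
have [[M1 max1 M1x] [M2 max2 M2y]] := (mem_maximal Px, mem_maximal Py).
have [M3 max3 M3xy] := mem_maximal (groupM Px Py).
apply: (@uniq_leq_size _ [:: M1; M2; M3]); last first.
  by move=> M; rewrite !inE mem_maximals => /or3P[]/eqP->.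
rewrite /= !inE negb_or andbT -andbA; apply/and3P; split; apply/eqP=> eqM.
- by rewrite -eqM in M2y; rewrite (negPf (not_generates_max max1 M1x M2y)) in genxy.
- by rewrite -eqM in M3xy; rewrite (negPf (not_generates_max max1 M1x M3xy)) in genx.
- by rewrite -eqM in M3xy; rewrite (negPf (not_generates_max max2 M2y M3xy)) in geny.
Qed.

(** Elements of Phi(P) can be dropped from any generating set, so a partner of
    u in Phi(P) would generate P alone. *)
Lemma gen_verts_notPhi u : u \in gen_verts P -> u \notin 'Phi(P).
Proof.
rewrite inE => /existsP[v genPuv]; apply: contra ncP => Phi_u.
have /andP[_ Pv] := generates_mem genPuv.
apply/cyclicP; exists v; symmetry; apply: Phi_nongen.
apply/eqP; rewrite eqEsubset join_subG Phi_sub sub1set Pv /=.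
by apply: (generates_sub genPuv); rewrite mem_gen // !inE ?Phi_u ?eqxx ?orbT.
Qed.

(** The blocks are the sets M - Phi(P) for M maximal.  Since there are at least
    three, entries at distance one or two lie in different blocks. *)
Lemma pgroup_gen_cycle : exists n d,
  gen_cycle P n d /\ forall i, generates P (d i) (d i.+2).
Proof.
pose q := size maximals; have q_gt2 : 2 < q := maximals_gt2.
have q_gt1 : 1 < q := ltnW q_gt2; have q_gt0 : 0 < q := ltnW q_gt1.
pose M i := nth 1%G maximals i.
have maxM i : i < q -> maximal (M i) P by move=> ltiq; rewrite -mem_maximals mem_nth.
have p_pr : prime p.
  by have [] := pgroup_pdiv pP; first by apply: contraNneq ncP => ->; apply: cyclic1.
pose B i := M i :\: 'Phi(P); pose k := (#|P| %/ p - #|'Phi(P)|)%N.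
have cardB i : i < q -> #|B i| = k.
  move=> /maxM maxMi; rewrite cardsD (setIidPr (Phi_sub_max maxMi)) /k.
  rewrite -(Lagrange (proper_sub (maxgroupp maxMi))) (p_maximal_index pP maxMi).
  by rewrite mulnK ?prime_gt0.
have disjB i j u : i < q -> j < q -> u \in B i -> u \in B j -> i = j.
  move=> ltiq ltjq /setDP[Mi_u Phi'u] /setDP[Mj_u _].
  apply/eqP; rewrite -(nth_uniq 1%G ltiq ltjq) ?enum_uniq //.
  apply: contraNT Phi'u => neq.
  by rewrite -(maximal_capE (maxM i _) (maxM j _)) // inE Mi_u.
have vertB u : u \in gen_verts P -> exists2 i, i < q & u \in B i.
  move=> Vu; have Pu := subsetP (gen_verts_sub P) _ Vu.
  have [K maxK Ku] := mem_maximal Pu.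
  exists (index K maximals); first by rewrite index_mem mem_maximals.
  by rewrite inE gen_verts_notPhi // /M nth_index ?mem_maximals.
have k_gt0 : 0 < k.
  have /andP[/vertB[i /cardB <- Bx] _] := gen_verts_mem genP.
  by apply/card_gt0P; exists x.
have [d [[n_gt0 dE d_onto] dB]] := cyclic_enum_blocks q_gt0 k_gt0 cardB disjB.
have gen_d i j : i != j %[mod q] -> generates P (d i) (d j).
  have [lti ltj] := (ltn_pmod i q_gt0, ltn_pmod j q_gt0) => neq.
  apply: (generates_maximal (maxM _ lti) (maxM _ ltj) _ (dB i) (dB j)).
  by rewrite nth_uniq ?enum_uniq.
have step i a : 0 < a < q -> generates P (d i) (d (i + a)%N).
  move=> /andP[a_gt0 lt_aq]; apply: gen_d.
  by rewrite -{1}[i]addn0 eqn_modDl mod0n modn_small // neq_ltn a_gt0.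
have step1 i : generates P (d i) (d i.+1) by rewrite -addn1; apply: step.
exists (q * k)%N, d; split; last by move=> i; rewrite -addn2; apply: step.
split=> //; split=> // u; rewrite -d_onto.
split=> [/vertB[i lti Bu] | /d_onto[i ->]].
  by apply/bigcupP; exists (Ordinal lti).
by have /andP[] := gen_verts_mem (step1 i).
Qed.
End PGroup.

(** * Nilpotent groups and the graph Delta *)

(** A nilpotent group with only cyclic Sylow subgroups is cyclic, so splitting
    off noncyclic Sylow subgroups ends with a cyclic group. *)
Lemma nilpotent_gen_cycle (gT : finGroupType) (G : {group gT}) x y :
  nilpotent G -> generates G x y -> exists n c, gen_cycle G n c.
Proof.
have [k] := ubnP #|G|; elim: k G x y => // k IHk G x y /ltnSE leGk nilG genG.
have [/cyclic_gen_cycle // | ncG] := boolP (cyclic G).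
have [V /SylowP[p _ sylV] ncV] : exists2 V : {group gT}, Sylow G V & ~~ cyclic V.
  case/boolP: (Zgroup G) => [ZG | ]; first by rewrite nil_Zgroup_cyclic in ncG.
  by case/forall_inPn=> V; exists V.
have defV := nilpotent_Hall_pcore nilG sylV.
have defG := nilpotent_pcoreC p nilG; rewrite -defV dprodC in defG.
have pV := pHall_pgroup sylV.
have co_HV : coprime #|'O_p^'(G)| #|V|.
  by rewrite defV coprime_sym coprime_pcoreC.
have /andP[Gx Gy] := generates_mem genG.
have [x1 [u [Hx Vu def_x _]]] := mem_dprod defG Gx.
have [y1 [v [Hy Vv def_y _]]] := mem_dprod defG Gy.
move: genG; rewrite def_x def_y (generates_dprod defG) // => /andP[genH genV].
have [n [d [cyc_d step2]]] := pgroup_gen_cycle pV ncV genV.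
have ltHk : #|'O_p^'(G)| < k.
  apply: leq_trans leGk; rewrite -(dprod_card defG) ltn_Pmulr ?cardG_gt0 //.
  by rewrite cardG_gt1; apply: contraNneq ncV => ->; apply: cyclic1.
have [m [c cyc_c]] := IHk _ _ _ ltHk (nilpotentS (pcore_sub _ _) nilG) genH.
exact: (dprod_gen_cycle defG co_HV cyc_c cyc_d step2).
Qed.

Lemma even_card_involution (T : finType) (f : T -> T) (A : {set T}) :
    involutive f -> {in A, forall x, f x \in A} -> {in A, forall x, f x != x} ->
  ~~ odd #|A|.
Proof.
move=> fK; have [k] := ubnP #|A|; elim: k A => // k IHk A leAk fA f_neq.
have [-> | [x Ax]] := set_0Vmem A; first by rewrite cards0.
have Afx : f x \in A :\ x by rewrite !inE f_neq // fA.
have cardA : #|A| = #|A :\ x :\ f x|.+2 by rewrite (cardsD1 x) Ax (cardsD1 (f x)) Afx.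
rewrite cardA /= negbK; apply: IHk => [|y|y]; first by rewrite cardA in leAk; lia.
  rewrite !inE => /and3P[neq_yfx neq_yx Ay].
  by rewrite (can_eq fK) neq_yx (inv_eq fK) neq_yfx fA.
by rewrite !inE => /and3P[_ _ /f_neq].
Qed.

Section Delta.
Variables (gT : finGroupType) (G : {group gT}).
Implicit Types x y z : gT.

Lemma adj_Delta x y : adj (Delta_graph G) x y = (x != y) && generates G x y.
Proof.
have adjE u v : adj (generating_graph G) u v = (u != v) && generates G u v.
  apply/and4P/andP=> [[] // | [neq_uv genuv]].
  by have /andP[] := generates_mem genuv.
rewrite -adjE; apply/and3P/idP=> [[_ _] // | adj_xy].
have [Gx Gy] := andP (adj_vertices adj_xy).
have adj_yx := adj_xy; rewrite adj_sym in adj_yx.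
split=> //; rewrite !inE negb_and negb_forall.
  by rewrite Gx /=; apply/existsP; exists y; rewrite negbK.
by rewrite Gy /=; apply/existsP; exists x; rewrite negbK.
Qed.

(** The two notions of generating pair differ only by loops: if x alone
    generates G <> 1, then x is not isolated because it is adjacent to 1. *)
Lemma vertices_Delta : G :!=: 1 -> vertices (Delta_graph G) = gen_verts G.
Proof.
move=> ntG; apply/setP=> x; rewrite [RHS]inE; apply/idP/existsP=> [ | [y genxy]].
  rewrite !inE negb_and negb_forall => /andP[Gx /andP[_]].
  rewrite Gx /= => /existsP[y]; rewrite negbK => /and4P[_ _ _ genxy].
  by exists y.
have [z adj_xz] : exists z, adj (Delta_graph G) x z.
  have [eq_xy | neq_xy] := eqVneq x y; last by exists y; rewrite adj_Delta neq_xy.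
  exists 1; rewrite adj_Delta; move: genxy; rewrite -eq_xy => gen_x.
  apply/andP; split.
    apply: contraNneq ntG => x1; move: gen_x.
    by rewrite /generates /= setUid x1 => /eqP <-; rewrite genGid.
  rewrite /generates /= eqEsubset gen_subG subUset !sub1set group1.
  have /andP[-> _] := generates_mem gen_x.
  by apply: (generates_sub gen_x); rewrite mem_gen ?set21.
by case/andP: (adj_vertices adj_xz).
Qed.

Lemma cyclic_neighbours x :
  generates G x x -> neighbours (Delta_graph G) x = G :\ x.
Proof.
move=> gen_x; apply/setP=> y; rewrite !inE adj_Delta eq_sym; apply: andb_id2l => _.
apply/idP/idP=> [/generates_mem/andP[] // | Gy].
have /andP[Gx _] := generates_mem gen_x.
rewrite /generates /= eqEsubset gen_subG subUset !sub1set Gx Gy.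
by apply: (generates_sub gen_x); rewrite mem_gen ?set21.
Qed.

(** A generator x of G is adjacent to all other elements.  If x does not
    generate G, its neighbours are paired off by y |-> y^-1 or y |-> y t, which
    replace y by an element that generates the same subgroup together with x. *)
Lemma even_degree x :
    nilpotent G -> ~ (cyclic G /\ ~~ odd #|G|) ->
  ~~ odd #|neighbours (Delta_graph G) x|.
Proof.
move=> nilG not_ev; have [gen_x | ngen_x] := boolP (generates G x x).
  have cycG := generates_cyclic gen_x.
  have oddG : odd #|G| by apply/negPn/negP=> evG; apply: not_ev.
  rewrite cyclic_neighbours //; move: oddG; rewrite (cardsD1 x G).
  by have /andP[-> _] := generates_mem gen_x.
have adjE y : (y \in neighbours (Delta_graph G) x) = generates G x y.
  rewrite inE adj_Delta andb_idl // => genxy.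
  by apply: contraNneq ngen_x => eq_xy; rewrite -eq_xy in genxy.
have [odd_x | even_x] := boolP (odd #[x]).
  apply: (@even_card_involution _ (fun y => y^-1)) => [|y|y]; first exact: invgK.
    rewrite !adjE => genxy; have /andP[_ Gy] := generates_mem genxy.
    by apply: (generates_replace genxy); rewrite ?groupV // -groupV mem_gen ?set22.
  (* A fixed point has order at most 2, coprime to the order of x. *)
  rewrite adjE => genxy; apply/eqP=> yV.
  have /andP[Gx Gy] := generates_mem genxy.
  have y2 : #[y] %| 2 by rewrite order_dvdn expgS expg1 -{1}yV mulVg.
  have co_xy : coprime #[x] #[y] by rewrite (coprime_dvdr y2) // coprimen2.
  have cxy : commute x y.
    apply/esym/(centsP (sub_nilpotent_cent2 nilG _ _ co_xy));
      by rewrite ?cycle_subG ?cycle_id.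
  have cycG : cyclic G.
    apply/cyclicP; exists (x * y); apply/eqP.
    rewrite eqEsubset cycle_subG groupM // andbT.
    rewrite -(eqP genxy) gen_subG subUset !sub1set -!cycle_subG cycleMsub //=.
    by rewrite cxy cycleMsub // coprime_sym.
  case: not_ev; split=> //; rewrite -dvdn2.
  apply: dvdn_trans (order_dvdG Gy).
  move: y2; rewrite dvdn_divisors // !inE => /orP[|/eqP->] //.
  rewrite order_eq1 => /eqP y1; case/negP: ngen_x.
  by rewrite y1 in genxy; apply: (generates_replace genxy); rewrite ?group1.
(* The involution of the cyclic group <x> of even order. *)
have [t [x_t t2 t1]] : exists t, [/\ t \in <[x]>, t * t = 1 & t != 1].
  exists (x ^+ #[x]./2); split; first exact: mem_cycle.
    by rewrite -expgD addnn even_halfK // expg_order.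
  rewrite -order_dvdn gtnNdvd //.
    by have := order_gt0 x; case: #[x] even_x => [|[]].
  by have := order_gt0 x; case: #[x] => // n _; rewrite ltn_half_double -addnn; lia.
apply: (@even_card_involution _ (fun y => y * t)) => [y|y|y].
- by rewrite -mulgA t2 mulg1.
- rewrite !adjE => genxy; have /andP[Gx Gy] := generates_mem genxy.
  have Gt : t \in G by apply: subsetP x_t; rewrite cycle_subG.
  have xyt_t : t \in <<[set x; y * t]>>.
    by apply: subsetP x_t; rewrite genS // sub1set set21.
  apply: (generates_replace genxy); first by rewrite groupM.
  by rewrite -[X in X \in _](mulgK t) groupM ?groupV // mem_gen ?set22.
by move=> _; rewrite -{2}[y]mulg1 (inj_eq (mulgI y)).
Qed.

(** A Hamiltonian cycle needs three vertices: in a noncyclic group, x, y and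
    x y are distinct because any two of them generate it. *)
Lemma gen_verts_gt2 x y :
  generates G x y -> G :!=: 1 -> ~ (cyclic G /\ #|G| = 2) -> 2 < #|gen_verts G|.
Proof.
move=> genxy ntG not2; have [cycG | ncG] := boolP (cyclic G).
  have [g gen_g] := cyclic_generates cycG.
  have -> : gen_verts G = G.
    apply/eqP; rewrite eqEsubset gen_verts_sub; apply/subsetP=> h Gh.
    rewrite inE; apply/existsP; exists g; rewrite generates_sym.
    by apply: (generates_replace gen_g) => //; rewrite mem_gen ?set21.
  rewrite ltn_neqAle cardG_gt1 ntG andbT eq_sym; apply/eqP=> G2.
  exact: not2.
have genxxy := generates_mulr genxy.
have genyxy := generates_mull genxy.
have neq u v : generates G u v -> u != v.
  by apply: contraTneq => ->; apply: contra ncG; apply: generates_cyclic.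
have uniq_V : uniq [:: x; y; x * y].
  by rewrite /= !inE negb_or !neq.
rewrite -[3]/(size [:: x; y; x * y]) cardE; apply: uniq_leq_size => // z.
have /andP[Vx Vy] := gen_verts_mem genxy; have /andP[_ Vxy] := gen_verts_mem genxxy.
by rewrite mem_enum in_cons in_cons mem_seq1 => /or3P[]/eqP->.
Qed.

(** In the cyclic list of V(G), two successive entries are distinct as soon as
    the period is at least 2, so the list avoids loops. *)
Lemma hamiltonian_Delta x y :
    generates G x y -> nilpotent G -> G :!=: 1 -> ~ (cyclic G /\ #|G| = 2) ->
  hamiltonian (Delta_graph G).
Proof.
move=> genxy nilG ntG not2.
have V_gt2 := gen_verts_gt2 genxy ntG not2.
have [n [c [enum_c step_c]]] := nilpotent_gen_cycle nilG genxy.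
apply: (@cyclic_enum_hamiltonian _ _ n c); rewrite ?vertices_Delta // => i.
rewrite adj_Delta step_c andbT.
have [n_gt0 cE c_onto] := enum_c; rewrite cE; apply/negP=> eq_mod.
have n1 : n = 1%N.
  by move: eq_mod; rewrite eq_sym eqn_mod_dvd // subSnn dvdn1 => /eqP.
suff: #|gen_verts G| <= 1 by lia.
rewrite -(cards1 (c 0)); apply/subset_leq_card/subsetP=> z /c_onto[j ->].
by rewrite inE cE n1 !modn1.
Qed.

End Delta.

Local Close Scope group_scope.

Theorem theorem2 (gT : finGroupType) (G : {group gT})
    (ntG : G :!=: 1%g) (gen2G : two_generated G) (nilG : nilpotent G) :
  (eulerian (Delta_graph G) <-> ~ (cyclic G /\ ~~ odd #|G|)) /\
  (hamiltonian (Delta_graph G) <-> ~ (cyclic G /\ #|G| = 2)).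
Proof.
have [x [y genG]] := gen2G; have genxy : generates G x y by apply/eqP.
have hamG := hamiltonian_Delta genxy nilG ntG.
split; split; last exact: hamG.
- move=> eulG [cycG evG]; have [g gen_g] := cyclic_generates cycG.
  have := eulerian_even_degree g eulG; rewrite cyclic_neighbours //.
  have /andP[Gg _] := generates_mem gen_g.
  by move: evG; rewrite (cardsD1 g G) Gg /= => /negbNE->.
- move=> not_ev; have /andP[Vx _] := gen_verts_mem genxy.
  apply: (@even_degree_eulerian _ _ x) => [||v]; first by rewrite vertices_Delta.
    have [|c [_ cyc_c _ mem_c]] := hamG.
      by case=> cycG G2; apply: not_ev; rewrite G2.
    by move=> u v Du Dv; apply: (connect_cycle cyc_c); rewrite mem_c.
  exact: even_degree.
move=> [c [c_gt2 _ uniq_c mem_c]] [_ G2].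
have : #|c| <= #|G|.
  rewrite (eq_card mem_c) vertices_Delta //.
  exact/subset_leq_card/gen_verts_sub.
by rewrite (card_uniqP uniq_c) G2 leqNgt c_gt2.
Qed.
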